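(* Let $H\in\mathbb{N}$ and $f\in C([0,1],\mathbb{R})$. For $\phi=(\phi_1,\dots,\phi_{3H+1})\in\mathbb{R}^{3H+1}$ and $j\in\{1,\dots,H\}$ write $\mathfrak{w}^\phi_j=\phi_j$, $\mathfrak{b}^\phi_j=\phi_{H+j}$, $\mathfrak{v}^\phi_j=\phi_{2H+j}$, $\mathfrak{c}^\phi=\phi_{3H+1}$, and $\|\phi\|=[\sum_{i=1}^{3H+1}|\phi_i|^2]^{1/2}$. For $\phi\in\mathbb{R}^{3H+1}$, $x\in\mathbb{R}$ let $$\mathscr{N}^\phi(x)=\mathfrak{c}^\phi+\sum_{j=1}^{H}\mathfrak{v}^\phi_j\max\{\mathfrak{w}^\phi_jx+\mathfrak{b}^\phi_j,0\},\qquad V(\phi)=\|\phi\|^2+|\mathfrak{c}^\phi|^2 .$$ Let $\mathcal{G}=(\mathcal{G}_1,\dots,\mathcal{G}_{3H+1})\colon\mathbb{R}^{3H+1}\to\mathbb{R}^{3H+1}$ satisfy for all $\phi\in\mathbb{R}^{3H+1}$, $j\in\{1,\dots,H\}$ that $$\mathcal{G}_j(\phi)=2\mathfrak{v}^\phi_j\int_0^1x\,(\mathscr{N}^\phi(x)-f(x))\,\mathbb{1}_{(0,\infty)}(\mathfrak{w}^\phi_jx+\mathfrak{b}^\phi_j)\,dx,$$ $$\mathcal{G}_{H+j}(\phi)=2\mathfrak{v}^\phi_j\int_0^1(\mathscr{N}^\phi(x)-f(x))\,\mathbb{1}_{(0,\infty)}(\mathfrak{w}^\phi_jx+\mathfrak{b}^\phi_j)\,dx,$$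 $$\mathcal{G}_{2H+j}(\phi)=2\int_0^1[\max\{\mathfrak{w}^\phi_jx+\mathfrak{b}^\phi_j,0\}]\,(\mathscr{N}^\phi(x)-f(x))\,dx,$$ $$\mathcal{G}_{3H+1}(\phi)=2\int_0^1(\mathscr{N}^\phi(x)-f(x))\,dx.$$ Let $\Theta\in C([0,\infty),\mathbb{R}^{3H+1})$ satisfy for all $t\in[0,\infty)$ that $\Theta_t=\Theta_0-\int_0^t\mathcal{G}(\Theta_s)\,ds$. Then (i) for all $t\in[0,\infty)$ it holds that $$V(\Theta_t)=V(\Theta_0)-8\int_0^t\int_0^1\mathscr{N}^{\Theta_s}(x)\,(\mathscr{N}^{\Theta_s}(x)-f(x))\,dx\,ds\le V(\Theta_0)+2t\int_0^1|f(x)|^2\,dx;$$ (ii) for all $t\in[0,\infty)$ it holds that $$\|\Theta_t\|\le(V(\Theta_0))^{1/2}+\Big[2\int_0^1|f(x)|^2\,dx\Big]^{1/2}t^{1/2}.$$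
   Context: $\mathbb{N}=\{1,2,\dots\}$; $\mathbb{1}_{A}$ denotes the indicator function of a set $A$. All other objects are defined in the claim. *)

(* Defs.v *)
From HB Require Import structures.
From mathcomp Require Import all_boot all_order all_algebra.
From mathcomp Require Import all_classical all_reals all_analysis.

Set Implicit Arguments.
Unset Strict Implicit.
Unset Printing Implicit Defensive.

Import Order.TTheory GRing.Theory Num.Theory.
Import numFieldNormedType.Exports.

Local Open Scope classical_set_scope.
Local Open Scope ring_scope.

(* The space R^(3H+1) is 'rV[R]_(3 * H).+1. Indices start at 0, so for
   j : 'I_H the 1-based coordinates j, H + j, 2H + j and 3H + 1 become j, H + j,
   2H + j and 3H. The arguments of inord are always < (3 * H).+1, hence inord
   never returns its default value here. *)
Definition idx_w (H : nat) (j : 'I_H) : 'I_(3 * H).+1 := inord j.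
Definition idx_b (H : nat) (j : 'I_H) : 'I_(3 * H).+1 := inord (H + j).
Definition idx_v (H : nat) (j : 'I_H) : 'I_(3 * H).+1 := inord (2 * H + j).
Definition idx_c (H : nat) : 'I_(3 * H).+1 := ord_max.

Section Network.
Context {R : realType} {H : nat}.
Implicit Types (phi : 'rV[R]_(3 * H).+1) (j : 'I_H) (x : R).

Definition wgt phi j : R := phi ord0 (idx_w j).
Definition bias phi j : R := phi ord0 (idx_b j).
Definition outw phi j : R := phi ord0 (idx_v j).
Definition outb phi : R := phi ord0 (idx_c H).

(* The library norm `|phi| on row vectors is the sup norm, not this one. *)
Definition eucl_norm phi : R :=
  Num.sqrt (\sum_(i < (3 * H).+1) `|phi ord0 i| ^+ 2).

Definition network phi x : R :=
  outb phi + \sum_(j < H) outw phi j * Num.max (wgt phi j * x + bias phi j) 0.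

Definition lyapunov phi : R := eucl_norm phi ^+ 2 + `|outb phi| ^+ 2.

End Network.

(* Main.v *)
Require Import Defs.
From HB Require Import structures.
From mathcomp Require Import all_boot all_order all_algebra.
From mathcomp Require Import all_classical all_reals all_analysis.
From mathcomp Require Import measurable_realfun ring lra zify.

Set Implicit Arguments.
Unset Strict Implicit.
Unset Printing Implicit Defensive.

Import Order.TTheory GRing.Theory Num.Theory.
Import numFieldNormedType.Exports.

Local Open Scope classical_set_scope.
Local Open Scope ring_scope.

(* The ReLU is positively homogeneous, so [w * G_w + b * G_b = v * G_v] for each
   neuron, and the chain rule gives
   [d/dt V = - 2 (<Theta, G(Theta)> + c * G_c(Theta)) = - 8 * \int N * (N - f)];
   the bound follows from [- N * (N - f) <= f ^ 2 / 4].
   Since [G] is discontinuous, [Theta] is only Lipschitz. The chain rule for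
   squares holds nevertheless: the defect of the integrated identity has
   increments quadratic in the time step, hence is constant. The integral of
   [G(Theta)] over time is meaningful because [s |-> G(Theta s)] is bounded and,
   by Tonelli, measurable. *)

(** * Bounded measurable functions on a set *)

Section BoundedMeasurable.
Context d (T : measurableType d) (R : realType).
Implicit Types (D : set T) (F K : T -> R).

(** This class is stable under sums, products, ReLU and Heaviside, and on a measurable set of finite
    measure it lies in $L^1$. Every integrability side condition below is thus checked by following
    the shape of the integrand. *)
Definition bounded_measurable D F :=
  measurable_fun D F /\ exists M : R, forall x, D x -> `|F x| <= M.

Lemma bounded_measurable_cst D (c : R) : bounded_measurable D (fun=> c).
Proof. by split; [exact: measurable_cst | exists `|c|]. Qed.

Lemma bounded_measurableD D F K : bounded_measurable D F ->
  bounded_measurable D K -> bounded_measurable D (fun x => F x + K x).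
Proof.
move=> [mF [M FM]] [mK [N KN]]; split; first exact: measurable_funD.
exists (M + N) => x Dx.
by rewrite (le_trans (ler_normD _ _))// lerD ?FM ?KN.
Qed.

Lemma bounded_measurableM D F K : bounded_measurable D F ->
  bounded_measurable D K -> bounded_measurable D (fun x => F x * K x).
Proof.
move=> [mF [M FM]] [mK [N KN]]; split; first exact: measurable_funM.
by exists (M * N) => x Dx; rewrite normrM ler_pM ?FM ?KN.
Qed.

Lemma bounded_measurableB D F K : bounded_measurable D F ->
  bounded_measurable D K -> bounded_measurable D (fun x => F x - K x).
Proof.
move=> bF [mK [N KN]]; apply: bounded_measurableD => //; split.
  exact: measurableT_comp.
by exists N => x Dx; rewrite normrN KN.
Qed.

Lemma bounded_measurable_sum (I : Type) (r : seq I) D (F : I -> T -> R) :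
  (forall i, bounded_measurable D (F i)) ->
  bounded_measurable D (fun x => \sum_(i <- r) F i x).
Proof.
move=> bF; elim: r => [|i r ih].
  under eq_fun do rewrite big_nil.
  exact: bounded_measurable_cst.
under eq_fun do rewrite big_cons.
exact: bounded_measurableD.
Qed.

Lemma bounded_measurable_relu D F : bounded_measurable D F ->
  bounded_measurable D (fun x => Num.max (F x) 0).
Proof.
move=> [mF [M FM]]; split; first exact: measurable_maxr.
exists M => x Dx; rewrite (le_trans _ (FM x Dx))//.
by rewrite /Num.max; case: ifP => // _; rewrite normr0.
Qed.

Lemma bounded_measurable_heaviside D F : bounded_measurable D F ->
  bounded_measurable D (fun x => \1_(`]0, +oo[) (F x)).
Proof.
move=> [mF _]; split.
  by apply: measurableT_comp => //; exact: measurable_indic.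
exists 1 => x _; rewrite indicE; case: (_ \in _); by rewrite ?normr1 ?normr0.
Qed.

Lemma sub_bounded_measurable D E F : measurable D -> E `<=` D ->
  bounded_measurable D F -> bounded_measurable E F.
Proof.
move=> mD ED [mF [M FM]]; split; first exact: measurable_funS mF.
by exists M => x /ED; exact: FM.
Qed.

Lemma bounded_measurable_integrable (mu : {measure set T -> \bar R}) D F :
  measurable D -> (mu D < +oo)%E -> bounded_measurable D F ->
  mu.-integrable D (EFin \o F).
Proof.
move=> mD Doo [mF [M FM]]; apply: measurable_bounded_integrable => //.
exists M; split; first exact: num_real.
by move=> N MN x /FM /le_trans; apply; exact: ltW.
Qed.

Lemma norm_Rintegral_le (mu : {measure set T -> \bar R}) D F M :
  measurable D -> (mu D < +oo)%E -> bounded_measurable D F ->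
  (forall x, D x -> `|F x| <= M) ->
  `|\int[mu]_(x in D) F x| <= M * fine (mu D).
Proof.
move=> mD Doo bF FM.
have iF := bounded_measurable_integrable mD Doo bF.
apply: (le_trans (le_normr_Rintegral mD iF)).
rewrite -Rintegral_cst//; apply: le_Rintegral => //.
- exact: integrable_norm iF.
- by apply: bounded_measurable_integrable => //; exact: bounded_measurable_cst.
Qed.

End BoundedMeasurable.

Lemma bounded_measurable_comp d1 d2 (T1 : measurableType d1)
    (T2 : measurableType d2) (R : realType) (D1 : set T1) (D2 : set T2)
    (h : T1 -> T2) (F : T2 -> R) :
  measurable D2 -> measurable_fun D1 h -> (forall x, D1 x -> D2 (h x)) ->
  bounded_measurable D2 F -> bounded_measurable D1 (F \o h).
Proof.
move=> mD2 mh D12 [mF [M FM]]; split.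
  by apply: measurable_comp mD2 _ mF mh => _ [x D1x <-]; exact: D12.
by exists M => x /D12; exact: FM.
Qed.

(** * Integrals depending on a parameter *)

Section ParametricIntegral.
Context d1 d2 (T1 : measurableType d1) (T2 : measurableType d2) (R : realType).
Variables (nu : {sigma_finite_measure set T2 -> \bar R}).
Variables (A : set T1) (B : set T2).
Hypotheses (mA : measurable A) (mB : measurable B).

Lemma bounded_measurable_section (F : T1 * T2 -> R) s : A s ->
  bounded_measurable (A `*` B) F -> bounded_measurable B (fun x => F (s, x)).
Proof.
move=> As; apply: (@bounded_measurable_comp _ _ _ _ _ _ _ (pair s)) => //.
  exact: measurableX.
exact: measurable_funTS.
Qed.

Lemma bounded_measurable_fst (F : T1 -> R) :
  bounded_measurable A F -> bounded_measurable (A `*` B) (fun p => F p.1).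
Proof.
apply: (@bounded_measurable_comp _ _ _ _ _ _ _ fst) => //.
  exact: measurable_funTS.
by move=> p [].
Qed.

Lemma bounded_measurable_snd (F : T2 -> R) :
  bounded_measurable B F -> bounded_measurable (A `*` B) (fun p => F p.2).
Proof.
apply: (@bounded_measurable_comp _ _ _ _ _ _ _ snd) => //.
  exact: measurable_funTS.
by move=> p [].
Qed.

(** If $|F|\le M$, the integral is at most $M\,\nu(B)$ in absolute value. For measurability, Tonelli
    is applied to the positive and negative parts of $F$. *)
Lemma bounded_measurable_Rintegral (F : T1 * T2 -> R) :
  (nu B < +oo)%E -> bounded_measurable (A `*` B) F ->
  bounded_measurable A (fun s => \int[nu]_(x in B) F (s, x)).
Proof.
move=> Boo bF; split; last first.
  have [_ [M FM]] := bF; exists (M * fine (nu B)) => s As.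
  apply: norm_Rintegral_le => //; first exact: bounded_measurable_section.
  by move=> x Bx; exact: FM.
have mAB : measurable (A `*` B) by exact: measurableX.
(* Tonelli is used on the whole product space, so [F] is extended by zero. For [s] in [A], the
   section of [K] at [s] is the section of [F] cut off outside [B], so the two integrals agree. *)
pose K := (F \_ (A `*` B))%R.
have mK : measurable_fun setT K.
  by case: bF => mF _; exact/(measurable_restrictT F mAB).
apply: (@eq_measurable_fun _ _ _ _ _
    (fun s => fine
      (fubini_F nu (EFin \o K)^\+ s - fubini_F nu (EFin \o K)^\- s)%E)).
  move=> s; rewrite inE => As.
  rewrite /Rintegral (integral_mkcond B) integralE /fubini_F; congr fine.
  have KE : (EFin \o (fun x => F (s, x))) \_ B = (fun x => (K (s, x))%:E).
    apply/funext => x; rewrite /K !patchE in_setX/= (mem_set As)/=.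
    by case: (x \in B).
  rewrite KE; congr (_ - _)%E; apply: eq_integral => x _.
    by rewrite !funeposE.
  by rewrite !funenegE.
apply: measurable_funTS; apply: measurableT_comp; first exact: fine_measurable.
apply: emeasurable_funB; apply: measurable_fun_fubini_tonelli_F.
- by apply: measurable_funepos; exact/measurable_EFinP.
- by move=> p; exact: funepos_ge0.
- by apply: measurable_funeneg; exact/measurable_EFinP.
- by move=> p; exact: funeneg_ge0.
Qed.

End ParametricIntegral.

(** * Integral equations in time and the chain rule for squares *)

Section Flow.
Context (R : realType).
Local Notation mu := (@lebesgue_measure R).
Implicit Types (a b s t : R) (h g theta : R -> R).

Lemma continuous_bounded_measurable a b h :
  {within `[a, b], continuous h} -> bounded_measurable `[a, b] h.
Proof.
move=> ch; split; first exact: subspace_continuous_measurable_fun.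
have [M [_ hM]] :=
  compact_bounded (continuous_compact ch (@segment_compact _ a b)).
(* Boundedness provides a bound by each number strictly above [M], hence the [+ 1]. *)
exists (M + 1) => x xab; apply: (hM (M + 1)); first by rewrite ltrDl.
by exists x.
Qed.

Lemma continuous_coord_bounded_measurable n (u : R -> 'rV[R]_n) t i :
  {within `[0, +oo[, continuous u} ->
  bounded_measurable `[0, t] (fun s => u s ord0 i).
Proof.
move=> cu; apply: continuous_bounded_measurable.
have : {within `[0, +oo[, continuous (fun s => u s ord0 i)}.
  move=> x.
  have ci : {for u x, continuous (fun M : 'rV[R]_n => M ord0 i)}.
    exact: coord_continuous.
  exact: (continuous_comp (cu x) ci).
by apply: continuous_subspaceW; apply: subset_itvl.
Qed.

Lemma fine_lebesgue_measure_itv (i j : bool) s t : s <= t ->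
  fine (mu [set` Interval (BSide i s) (BSide j t)]) = t - s.
Proof.
move=> st; rewrite lebesgue_measure_itv/= lte_fin; case: ltP => [//|ts].
by rewrite (le_anti (introT andP (conj st ts))) subrr.
Qed.

Lemma lebesgue_measure_itv_lty (i j : bool) s t :
  (mu [set` Interval (BSide i s) (BSide j t)] < +oo)%E.
Proof. by rewrite lebesgue_measure_itv/=; case: ifP => _; rewrite ?ltey. Qed.

Lemma norm_Rintegral_itvoc_le a b h M s t : a <= s -> s <= t -> t <= b ->
  bounded_measurable `[a, b] h -> (forall r, r \in `]s, t] -> `|h r| <= M) ->
  `|\int[mu]_(r in `]s, t]) h r| <= M * (t - s).
Proof.
move=> as_ st tb bh hM; rewrite -(fine_lebesgue_measure_itv false false)//.
apply: norm_Rintegral_le => //; first exact: lebesgue_measure_itv_lty.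
apply: sub_bounded_measurable bh => //.
by apply: subset_itv; rewrite bnd_simp.
Qed.

(** The half-open interval makes [[0, s]] and []s, t]] a partition of [[0, t]], including the case
    [s = t]. *)
Lemma Rintegral_increment (T : R) h s t : 0 <= s -> s <= t -> t <= T ->
  bounded_measurable `[0, T] h ->
  \int[mu]_(r in `[0, t]) h r - \int[mu]_(r in `[0, s]) h r =
  \int[mu]_(r in `]s, t]) h r.
Proof.
move=> s0 st tT bh; rewrite Rintegral_itvB ?bnd_simp//.
apply: bounded_measurable_integrable => //.
  exact: lebesgue_measure_itv_lty.
apply: sub_bounded_measurable bh => //.
by apply: subset_itv; rewrite bnd_simp.
Qed.

(* Halving the interval halves the bound [C * (t - s) ^+ 2]. *)
Lemma quadratic_increment_eq a b C h : a <= b ->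
  (forall s t, a <= s -> s <= t -> t <= b ->
    `|h t - h s| <= C * (t - s) ^+ 2) ->
  h b = h a.
Proof.
move=> ab hC.
(* Each half of [[s, t]] contributes a quarter of $C(t-s)^2$, so their sum gains a factor 2 at each
   stage. *)
have halved (n : nat) s t : a <= s -> s <= t -> t <= b ->
    `|h t - h s| * 2 ^+ n <= C * (t - s) ^+ 2.
  elim: n s t => [|n ih] s t as_ st tb; first by rewrite expr0 mulr1 hC.
  pose m := (s + t) / 2.
  have sm : s <= m by rewrite /m; lra.
  have mt : m <= t by rewrite /m; lra.
  have := ih _ _ as_ sm (le_trans mt tb).
  have := ih _ _ (le_trans as_ sm) mt tb.
  have -> : t - m = (t - s) / 2 by rewrite /m; field.
  have -> : m - s = (t - s) / 2 by rewrite /m; field.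
  have : `|h t - h s| * 2 ^+ n <= (`|h t - h m| + `|h m - h s|) * 2 ^+ n.
    by rewrite ler_wpM2r ?exprn_ge0//; apply: ler_distD.
  have -> : C * ((t - s) / 2) ^+ 2 = C * (t - s) ^+ 2 / 4 by field.
  rewrite mulrDl => Hd Hr Hl.
  rewrite exprS mulrCA; lra.
apply/eqP; rewrite -subr_eq0 -normr_eq0 eq_le normr_ge0 andbT leNgt.
apply/negP => d_gt0.
set K := C * (b - a) ^+ 2 in halved.
(* With $d=|h(b)-h(a)|>0$ this gives $K<nd\le 2^n d$, against [halved] at [n]. *)
pose n := (Num.truncn (K / `|h b - h a|)).+1.
have : K / `|h b - h a| < n%:R by exact: truncnS_gt.
rewrite ltr_pdivrMr// => Kn.
have := halved n a b (lexx _) ab (lexx _).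
apply/negP; rewrite -ltNge (lt_le_trans Kn)// mulrC ler_wpM2l//.
by rewrite -natrX ler_nat ltnW// ltn_expl.
Qed.

(** This is $(\theta^2)'=-2\theta g$ in integrated form, for a merely Lipschitz $\theta$. Since
    $\theta_t^2-\theta_s^2=-(\theta_t+\theta_s)\int_s^t g$, the defect [E] has increment
    $\int_s^t(2\theta_r-\theta_t-\theta_s)\,g_r\,dr$. Both the bracket and the length of the
    interval are of order $t-s$, so the increment is quadratic and [E] is constant. *)
Lemma sqr_flow (T : R) g theta : 0 <= T ->
  bounded_measurable `[0, T] g -> bounded_measurable `[0, T] theta ->
  (forall t, 0 <= t -> t <= T ->
    theta t = theta 0 - \int[mu]_(r in `[0, t]) g r) ->
  theta T ^+ 2 = theta 0 ^+ 2 - 2 * \int[mu]_(r in `[0, T]) (theta r * g r).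
Proof.
move=> T0 bg bth flow.
have bthg := bounded_measurableM bth bg.
have [_ [M gM]] := bg.
(* The bound is evaluated at time 0, which lies in [[0, T]]. *)
have M0 : 0 <= M by rewrite (le_trans _ (gM 0 _))//= in_itv/= lexx.
have incr s t : 0 <= s -> s <= t -> t <= T ->
    theta t - theta s = - \int[mu]_(r in `]s, t]) g r.
  move=> s0 st tT.
  rewrite (flow t)// ?(le_trans s0)// (flow s)// ?(le_trans st)//.
  by rewrite -(Rintegral_increment s0 st tT bg); ring.
have lip s t : 0 <= s -> s <= t -> t <= T ->
    `|theta t - theta s| <= M * (t - s).
  move=> s0 st tT; rewrite incr// normrN.
  apply: (norm_Rintegral_itvoc_le s0 st tT bg) => r /=.
  rewrite in_itv/= => /andP[sr rt]; apply: gM; rewrite /= in_itv/=.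
  by rewrite (le_trans s0 (ltW sr)) (le_trans rt tT).
pose E t := theta t ^+ 2 + 2 * \int[mu]_(r in `[0, t]) (theta r * g r).
suff : E T = E 0.
  rewrite /E set_itv1 Rintegral_set1; lra.
apply: (@quadratic_increment_eq _ _ (2 * M ^+ 2)) => // s t s0 st tT.
have bsum : bounded_measurable `[0, T]
    (fun r => 2 * theta r - (theta t + theta s)).
  apply: bounded_measurableB; last exact: bounded_measurable_cst.
  by apply: bounded_measurableM => //; exact: bounded_measurable_cst.
have -> : E t - E s =
    \int[mu]_(r in `]s, t]) ((2 * theta r - (theta t + theta s)) * g r).
  have sub : `]s, t] `<=` `[0, T] by apply: subset_itv; rewrite bnd_simp.
  have int_oc k : bounded_measurable `[0, T] k ->
      mu.-integrable `]s, t] (EFin \o k).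
    move=> bk; apply: bounded_measurable_integrable => //.
      exact: lebesgue_measure_itv_lty.
    exact: sub_bounded_measurable bk.
  transitivity (\int[mu]_(r in `]s, t])
      (2 * (theta r * g r) - (theta t + theta s) * g r)); last first.
    by apply: eq_Rintegral => r _; ring.
  rewrite RintegralB//; last 2 first.
  - apply: int_oc; apply: bounded_measurableM => //.
    exact: bounded_measurable_cst.
  - apply: int_oc; apply: bounded_measurableM => //.
    exact: bounded_measurable_cst.
  rewrite !RintegralZl//; [|exact: int_oc|exact: int_oc].
  rewrite -(Rintegral_increment s0 st tT bthg) /E.
  have -> : \int[mu]_(r in `]s, t]) g r = - (theta t - theta s).
    by rewrite incr// opprK.
  ring.
have -> : 2 * M ^+ 2 * (t - s) ^+ 2 = (2 * M * (t - s)) * M * (t - s) by ring.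
apply: (norm_Rintegral_itvoc_le s0 st tT) => [|r /=].
  exact: bounded_measurableM.
rewrite in_itv/= => /andP[sr rt].
have r0 : 0 <= r := le_trans s0 (ltW sr).
have rT : r <= T := le_trans rt tT.
rewrite normrM; apply: ler_pM => //; last by apply: gM; rewrite /= in_itv/= r0.
(* By the Lipschitz bound the two differences are at most $M(r-s)$ and $M(t-r)$, which add up to
   $M(t-s)\le 2M(t-s)$. *)
have -> : 2 * theta r - (theta t + theta s) =
  (theta r - theta s) - (theta t - theta r) by ring.
have := lip _ _ s0 (ltW sr) rT; have := lip _ _ r0 rt tT.
have := ler_normB (theta r - theta s) (theta t - theta r).
have : M * (r - s) + M * (t - r) = M * (t - s) by ring.
have : 0 <= M * (t - s) by rewrite mulr_ge0// subr_ge0.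
lra.
Qed.

End Flow.

(** * Finite sums under the integral *)

Section RintegralSum.
Context d (T : measurableType d) (R : realType).
Variables (mu : {measure set T -> \bar R}) (D : set T).
Hypotheses (mD : measurable D) (Doo : (mu D < +oo)%E).

Lemma Rintegral_sum (I : Type) (r : seq I) (F : I -> T -> R) :
  (forall i, bounded_measurable D (F i)) ->
  \int[mu]_(x in D) (\sum_(i <- r) F i x) =
  \sum_(i <- r) \int[mu]_(x in D) F i x.
Proof.
move=> bF; elim: r => [|i r ih].
  under eq_Rintegral do rewrite big_nil.
  by rewrite big_nil Rintegral_cst// mul0r.
under eq_Rintegral do rewrite big_cons.
rewrite big_cons RintegralD ?ih//.
- exact: bounded_measurable_integrable.
- apply: bounded_measurable_integrable => //.
  exact: bounded_measurable_sum.
Qed.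

End RintegralSum.

(** * The coordinates of the parameter vector *)

Section Index.
Variable H : nat.

(** The last coordinate is split off, the range below [3 * H] is cut at [H] and [2 * H], and each
    block is shifted back to start at 0, so that the terms are regrouped neuron by neuron. *)
Lemma sum_idx (V : nmodType) (F : 'I_(3 * H).+1 -> V) :
  \sum_i F i =
  \sum_(j < H) (F (idx_w j) + F (idx_b j) + F (idx_v j)) + F (idx_c H).
Proof.
rewrite big_ord_recr /=; congr (_ + _).
(* Indexing by natural numbers through [inord] allows the range to be cut and shifted. *)
have -> : \sum_(i < 3 * H) F (widen_ord (leqnSn _) i) =
    \sum_(0 <= k < 3 * H) F (inord k).
  rewrite big_mkord; apply: eq_bigr => i _; congr F; apply/val_inj => /=.
  by rewrite inordK// ltnS ltnW.
rewrite (@big_cat_nat _ _ _ H) ?leq_pmull//= (@big_cat_nat _ _ _ (2 * H) H);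
  [|by rewrite leq_pmull|by rewrite leq_mul2r orbT].
have shift a b (K : nat -> V) :
    \sum_(a <= k < b) K k = \sum_(0 <= k < b - a) K (k + a)%N.
  by rewrite -{1}(add0n a) big_addn.
rewrite (shift H) (shift (2 * H)%N).
have -> : (2 * H - H = H)%N by lia.
have -> : (3 * H - 2 * H = H)%N by lia.
rewrite !big_mkord !big_split/= addrA; congr (_ + _ + _).
- by apply: eq_bigr => i _; rewrite /idx_b addnC.
- by apply: eq_bigr => i _; rewrite /idx_v addnC.
Qed.

(** Comparing [i] with [H], [2 * H] and [3 * H] shows that the four families exhaust the
    coordinates. *)
Lemma idx_ind (P : 'I_(3 * H).+1 -> Prop) :
  (forall j, P (idx_w j)) -> (forall j, P (idx_b j)) ->
  (forall j, P (idx_v j)) -> P (idx_c H) -> forall i, P i.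
Proof.
move=> Pw Pb Pv Pc i.
have [iH|Hi] := ltnP i H.
  rewrite (_ : i = idx_w (Ordinal iH))//; apply: val_inj => /=.
  by rewrite inordK//=; lia.
have [i2H|H2i] := ltnP i (2 * H).
  have iH : (i - H < H)%N by lia.
  rewrite (_ : i = idx_b (Ordinal iH))//; apply: val_inj => /=.
  by rewrite inordK/= subnKC.
have [i3H|H3i] := ltnP i (3 * H).
  have iH : (i - 2 * H < H)%N by lia.
  rewrite (_ : i = idx_v (Ordinal iH))//; apply: val_inj => /=.
  by rewrite inordK/= subnKC.
rewrite (_ : i = idx_c H)//; apply: val_inj => /=.
by apply/eqP; rewrite eqn_leq H3i andbT -ltnS ltn_ord.
Qed.

End Index.

(** * Joint bounded measurability, in time and space, of the network and the gradient integrands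
    along a curve of parameters *)

Section NetworkMeasurable.
Context (R : realType) (H : nat) (A : set R).
Local Notation I01 := (`[(0 : R), 1]%classic).
Local Notation mu := (@lebesgue_measure R).
Variables (f : R -> R) (Theta : R -> 'rV[R]_(3 * H).+1).
Hypotheses (mA : measurable A) (bf : bounded_measurable I01 f).
Hypothesis bTheta : forall i, bounded_measurable A (fun s => Theta s ord0 i).

Let bTheta_fst i :
  bounded_measurable (A `*` I01) (fun p => Theta p.1 ord0 i).
Proof. exact: (bounded_measurable_fst _ mA (bTheta i)). Qed.

Lemma bounded_measurable_id01 : bounded_measurable I01 id.
Proof.
apply: continuous_bounded_measurable; apply: continuous_subspaceT => x.
exact: cvg_id.
Qed.

Let bx_snd : bounded_measurable (A `*` I01) (fun p => p.2).
Proof.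
exact: (bounded_measurable_snd _ (measurable_itv _) bounded_measurable_id01).
Qed.

Let bpreact j : bounded_measurable (A `*` I01)
  (fun p => wgt (Theta p.1) j * p.2 + bias (Theta p.1) j).
Proof.
apply: bounded_measurableD; last exact: bTheta_fst.
by apply: bounded_measurableM => //; exact: bTheta_fst.
Qed.

Lemma bounded_measurable_network :
  bounded_measurable (A `*` I01) (fun p => network (Theta p.1) p.2).
Proof.
apply: bounded_measurableD; first exact: bTheta_fst.
apply: bounded_measurable_sum => j.
apply: bounded_measurableM; first exact: bTheta_fst.
exact: bounded_measurable_relu.
Qed.

Lemma bounded_measurable_residual :
  bounded_measurable (A `*` I01) (fun p => network (Theta p.1) p.2 - f p.2).
Proof.
apply: bounded_measurableB; first exact: bounded_measurable_network.
exact: bounded_measurable_snd.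
Qed.

Lemma bounded_measurable_grad_w j : bounded_measurable (A `*` I01)
  (fun p => p.2 * (network (Theta p.1) p.2 - f p.2) *
     \1_(`]0, +oo[) (wgt (Theta p.1) j * p.2 + bias (Theta p.1) j)).
Proof.
apply: bounded_measurableM; last exact: bounded_measurable_heaviside.
by apply: bounded_measurableM => //; exact: bounded_measurable_residual.
Qed.

Lemma bounded_measurable_grad_b j : bounded_measurable (A `*` I01)
  (fun p => (network (Theta p.1) p.2 - f p.2) *
     \1_(`]0, +oo[) (wgt (Theta p.1) j * p.2 + bias (Theta p.1) j)).
Proof.
apply: bounded_measurableM; last exact: bounded_measurable_heaviside.
exact: bounded_measurable_residual.
Qed.

Lemma bounded_measurable_grad_v j : bounded_measurable (A `*` I01)
  (fun p => Num.max (wgt (Theta p.1) j * p.2 + bias (Theta p.1) j) 0 *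
     (network (Theta p.1) p.2 - f p.2)).
Proof.
apply: bounded_measurableM; last exact: bounded_measurable_residual.
exact: bounded_measurable_relu.
Qed.

Lemma bounded_measurable_energy : bounded_measurable (A `*` I01)
  (fun p => network (Theta p.1) p.2 * (network (Theta p.1) p.2 - f p.2)).
Proof.
apply: bounded_measurableM; last exact: bounded_measurable_residual.
exact: bounded_measurable_network.
Qed.

End NetworkMeasurable.

(** * The ReLU identity and elementary facts on the Lyapunov function *)

Section Lyapunov.
Context (R : realType) (H : nat).

(** This is Euler's identity for the positively homogeneous ReLU. At [y = 0] both sides vanish,
    whatever value the derivative is given there. *)
Lemma relu_heaviside (y : R) : Num.max y 0 = y * \1_(`]0, +oo[) y.
Proof.
by rewrite indicE mem_setE in_itv/= andbT; case: ltP; rewrite ?mulr1 ?mulr0.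
Qed.

Lemma lyapunovE (phi : 'rV[R]_(3 * H).+1) :
  lyapunov phi = \sum_i phi ord0 i ^+ 2 + phi ord0 (idx_c H) ^+ 2.
Proof.
rewrite /lyapunov /eucl_norm sqr_sqrtr; last by apply: sumr_ge0.
rewrite real_normK ?num_real//; congr (_ + _).
by apply: eq_bigr => i _; rewrite real_normK ?num_real.
Qed.

Lemma lyapunov_ge0 (phi : 'rV[R]_(3 * H).+1) : 0 <= lyapunov phi.
Proof. by rewrite addr_ge0 ?sqr_ge0. Qed.

Lemma eucl_norm_le_lyapunov (phi : 'rV[R]_(3 * H).+1) :
  eucl_norm phi <= Num.sqrt (lyapunov phi).
Proof.
have e0 : 0 <= eucl_norm phi by exact: sqrtr_ge0.
rewrite -[leLHS](ger0_norm e0) -sqrtr_sqr.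
by rewrite ler_wsqrtr// lerDl exprn_ge0.
Qed.

End Lyapunov.

(** * The Lyapunov identity and estimate along the gradient flow *)

Section GradientFlow.
Context (R : realType) (H : nat).
Local Notation mu := (@lebesgue_measure R).
Local Notation I01 := (`[(0 : R), 1]%classic).
Variables (f : R -> R) (G : 'rV[R]_(3 * H).+1 -> 'rV[R]_(3 * H).+1).
Hypothesis f_cont : {within `[0, 1], continuous f}.
Hypothesis G_w : forall (phi : 'rV[R]_(3 * H).+1) (j : 'I_H),
  G phi ord0 (idx_w j) =
  2 * outw phi j * \int[mu]_(x in `[0, 1])
    (x * (network phi x - f x) * \1_(`]0, +oo[) (wgt phi j * x + bias phi j)).
Hypothesis G_b : forall (phi : 'rV[R]_(3 * H).+1) (j : 'I_H),
  G phi ord0 (idx_b j) =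
  2 * outw phi j * \int[mu]_(x in `[0, 1])
    ((network phi x - f x) * \1_(`]0, +oo[) (wgt phi j * x + bias phi j)).
Hypothesis G_v : forall (phi : 'rV[R]_(3 * H).+1) (j : 'I_H),
  G phi ord0 (idx_v j) =
  2 * \int[mu]_(x in `[0, 1])
    (Num.max (wgt phi j * x + bias phi j) 0 * (network phi x - f x)).
Hypothesis G_c : forall phi : 'rV[R]_(3 * H).+1,
  G phi ord0 (idx_c H) = 2 * \int[mu]_(x in `[0, 1]) (network phi x - f x).

Let bf : bounded_measurable I01 f.
Proof. exact: continuous_bounded_measurable. Qed.

Let I01_lty : (mu I01 < +oo)%E.
Proof. exact: lebesgue_measure_itv_lty. Qed.

(** Along a curve, each coordinate of [G] is a constant, possibly times an outer weight, times a
    parametric integral of a jointly bounded measurable integrand. No continuity of [G] enters. *)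
Lemma bounded_measurable_gradient (A : set R)
    (Theta : R -> 'rV[R]_(3 * H).+1) i : measurable A ->
  (forall i, bounded_measurable A (fun s => Theta s ord0 i)) ->
  bounded_measurable A (fun s => G (Theta s) ord0 i).
Proof.
move=> mA bTheta; elim/idx_ind: i => [j|j|j|].
- under eq_fun do rewrite G_w.
  apply: bounded_measurableM.
    apply: bounded_measurableM; first exact: bounded_measurable_cst.
    exact: bTheta.
  exact: (bounded_measurable_Rintegral mA _ I01_lty
    (bounded_measurable_grad_w mA bf bTheta j)).
- under eq_fun do rewrite G_b.
  apply: bounded_measurableM.
    apply: bounded_measurableM; first exact: bounded_measurable_cst.
    exact: bTheta.
  exact: (bounded_measurable_Rintegral mA _ I01_lty
    (bounded_measurable_grad_b mA bf bTheta j)).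
- under eq_fun do rewrite G_v.
  apply: bounded_measurableM; first exact: bounded_measurable_cst.
  exact: (bounded_measurable_Rintegral mA _ I01_lty
    (bounded_measurable_grad_v mA bf bTheta j)).
- under eq_fun do rewrite G_c.
  apply: bounded_measurableM; first exact: bounded_measurable_cst.
  exact: (bounded_measurable_Rintegral mA _ I01_lty
    (bounded_measurable_residual mA bf bTheta)).
Qed.

(** A fixed parameter is treated as a constant curve and evaluated at time 0, so the joint
    statements also cover integrands for a single [phi]. *)
Let section01 (F : R * R -> R) :
  bounded_measurable ([set: R] `*` I01) F ->
  bounded_measurable I01 (fun x => F (0, x)).
Proof. by apply: bounded_measurable_section. Qed.

Let cst_coord (phi : 'rV[R]_(3 * H).+1) i :
  bounded_measurable [set: R] (fun=> phi ord0 i).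
Proof. exact: bounded_measurable_cst. Qed.

Let integrable01 (F : R -> R) : bounded_measurable I01 F ->
  mu.-integrable I01 (EFin \o F).
Proof. by move=> bF; apply: bounded_measurable_integrable. Qed.

(** By [neuron], each neuron contributes twice its outer-weight term, that is
    $4v_j\int\max\{w_jx+b_j,0\}(\mathscr N-f)$. The second copy of the output-bias term, coming from
    $|\mathfrak c|^2$ in $V$, brings it to $4\mathfrak c\int(\mathscr N-f)$, and the common factor 4
    lets the sum reassemble $\mathscr N$. *)
Lemma dot_gradient (phi : 'rV[R]_(3 * H).+1) :
  \sum_i phi ord0 i * G phi ord0 i + outb phi * G phi ord0 (idx_c H) =
  4 * \int[mu]_(x in `[0, 1]) (network phi x * (network phi x - f x)).
Proof.
have bw j :=
  section01 (bounded_measurable_grad_w measurableT bf (cst_coord phi) j).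
have bb j :=
  section01 (bounded_measurable_grad_b measurableT bf (cst_coord phi) j).
have bv j :=
  section01 (bounded_measurable_grad_v measurableT bf (cst_coord phi) j).
have bc :=
  section01 (bounded_measurable_residual measurableT bf (cst_coord phi)).
rewrite /= in bw bb bv bc.
have neuron j : phi ord0 (idx_w j) * G phi ord0 (idx_w j) +
    phi ord0 (idx_b j) * G phi ord0 (idx_b j) =
    phi ord0 (idx_v j) * G phi ord0 (idx_v j).
  rewrite G_w G_b G_v.
  transitivity (2 * outw phi j * (wgt phi j * \int[mu]_(x in `[0, 1])
      (x * (network phi x - f x) *
        \1_(`]0, +oo[) (wgt phi j * x + bias phi j)) +
      bias phi j * \int[mu]_(x in `[0, 1]) ((network phi x - f x) *
        \1_(`]0, +oo[) (wgt phi j * x + bias phi j)))).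
    by rewrite /wgt /bias; ring.
  rewrite -RintegralZl//; last exact: integrable01.
  rewrite -RintegralZl//; last exact: integrable01.
  rewrite -RintegralD//; last 2 first.
  - apply: integrable01; apply: bounded_measurableM; last exact: bw.
    exact: bounded_measurable_cst.
  - apply: integrable01; apply: bounded_measurableM; last exact: bb.
    exact: bounded_measurable_cst.
  rewrite -mulrA mulrCA; congr (_ * (_ * _)).
  by apply: eq_Rintegral => x _; rewrite relu_heaviside; ring.
rewrite sum_idx; under eq_bigr do rewrite neuron.
transitivity (4 * (outb phi * \int[mu]_(x in `[0, 1]) (network phi x - f x) +
  \sum_(j < H) outw phi j * \int[mu]_(x in `[0, 1])
    (Num.max (wgt phi j * x + bias phi j) 0 * (network phi x - f x)))).
  rewrite G_c mulrDr mulr_sumr -addrA addrC; congr (_ + _).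
    by rewrite /outb; ring.
  by apply: eq_bigr => j _; rewrite G_v /outw; ring.
congr (_ * _).
rewrite -RintegralZl//; last exact: integrable01.
under eq_bigr do rewrite -RintegralZl ?integrable01//.
rewrite -Rintegral_sum//; last first.
  move=> j; apply: bounded_measurableM; last exact: bv.
  exact: bounded_measurable_cst.
rewrite -RintegralD//; last 2 first.
- apply: integrable01; apply: bounded_measurableM; last exact: bc.
  exact: bounded_measurable_cst.
- apply: integrable01; apply: bounded_measurable_sum => j.
  apply: bounded_measurableM; last exact: bv.
  exact: bounded_measurable_cst.
(* Only the factor [network phi x] outside the residual is expanded. *)
apply: eq_Rintegral => x _; rewrite {3}/network mulrDl mulr_suml.
by congr (_ + _); apply: eq_bigr => j _; rewrite mulrA.
Qed.

(** Completing the square: $\mathscr N(\mathscr N-f)+f^2/4=(\mathscr N-f/2)^2\ge 0$. *)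
Lemma energy_ge (phi : 'rV[R]_(3 * H).+1) :
  - (4^-1 * \int[mu]_(x in `[0, 1]) (`|f x| ^+ 2)) <=
  \int[mu]_(x in `[0, 1]) (network phi x * (network phi x - f x)).
Proof.
have be :=
  section01 (bounded_measurable_energy measurableT bf (cst_coord phi)).
have bf2 : bounded_measurable I01 (fun x => `|f x| ^+ 2).
  rewrite (_ : (fun x => _) = fun x => f x * f x).
    exact: bounded_measurableM.
  by apply/funext => x; rewrite real_normK ?num_real.
rewrite -mulNr -RintegralZl//; last exact: integrable01.
apply: le_Rintegral => //.
- apply: integrable01; apply: bounded_measurableM => //.
  exact: bounded_measurable_cst.
- exact: integrable01.
move=> x _; rewrite real_normK ?num_real//.
by have := sqr_ge0 (network phi x - f x / 2); nra.
Qed.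

(** Summing [sqr_flow] over all coordinates, with the output bias counted once more, gives $-2$
    times the time integral of the left side of [dot_gradient]; hence the constant $8=2\cdot 4$. *)
Lemma lyapunov_flow (Theta : R -> 'rV[R]_(3 * H).+1) (t : R) :
  {within `[0, +oo[, continuous Theta} ->
  (forall t, 0 <= t -> forall i, Theta t ord0 i =
    Theta 0 ord0 i - \int[mu]_(s in `[0, t]) (G (Theta s) ord0 i)) ->
  0 <= t ->
  lyapunov (Theta t) = lyapunov (Theta 0) -
    8 * \int[mu]_(s in `[0, t]) (\int[mu]_(x in `[0, 1])
      (network (Theta s) x * (network (Theta s) x - f x))).
Proof.
move=> cTheta flow t0.
have bTheta i := continuous_coord_bounded_measurable t i cTheta.
have mt : measurable (`[0, t]%classic : set R) by [].
have bG i := bounded_measurable_gradient i mt bTheta.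
have bThetaG i := bounded_measurableM (bTheta i) (bG i).
have tlty : (mu `[0%R, t] < +oo)%E by exact: lebesgue_measure_itv_lty.
have sqr i : Theta t ord0 i ^+ 2 = Theta 0 ord0 i ^+ 2 -
    2 * \int[mu]_(s in `[0, t]) (Theta s ord0 i * G (Theta s) ord0 i).
  apply: (sqr_flow t0 (bG i) (bTheta i)) => s s0 _; exact: flow.
rewrite !lyapunovE sqr; under eq_bigr do rewrite sqr.
rewrite big_split/= sumrN -mulr_sumr -Rintegral_sum//.
have -> : \int[mu]_(s in `[0, t]) (\int[mu]_(x in `[0, 1])
      (network (Theta s) x * (network (Theta s) x - f x))) =
    4^-1 * (\int[mu]_(s in `[0, t])
        (\sum_i Theta s ord0 i * G (Theta s) ord0 i) +
      \int[mu]_(s in `[0, t])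
        (Theta s ord0 (idx_c H) * G (Theta s) ord0 (idx_c H))).
  rewrite -RintegralD//; last 2 first.
  - apply: bounded_measurable_integrable => //.
    by apply: bounded_measurable_sum => i; exact: bThetaG.
  - by apply: bounded_measurable_integrable => //; exact: bThetaG.
  rewrite -RintegralZl//; last first.
    apply: bounded_measurable_integrable => //.
    apply: bounded_measurableD; last exact: bThetaG.
    by apply: bounded_measurable_sum => i; exact: bThetaG.
  apply: eq_Rintegral => s _.
  by rewrite -/(outb (Theta s)) dot_gradient mulKf.
lra.
Qed.

(** Integrating [energy_ge] over [[0, t]] bounds the double integral below by $-tc/4$ with
    $c=\int_0^1|f|^2$, and $8\cdot tc/4=2tc$. *)
Lemma lyapunov_flow_le (Theta : R -> 'rV[R]_(3 * H).+1) (t : R) :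
  {within `[0, +oo[, continuous Theta} -> 0 <= t ->
  lyapunov (Theta 0) -
    8 * \int[mu]_(s in `[0, t]) (\int[mu]_(x in `[0, 1])
      (network (Theta s) x * (network (Theta s) x - f x))) <=
  lyapunov (Theta 0) + 2 * t * \int[mu]_(x in `[0, 1]) (`|f x| ^+ 2).
Proof.
move=> cTheta t0.
have bTheta i := continuous_coord_bounded_measurable t i cTheta.
have mt : measurable (`[0, t]%classic : set R) by [].
have tlty : (mu `[0%R, t] < +oo)%E by exact: lebesgue_measure_itv_lty.
have be : bounded_measurable `[0, t] (fun s => \int[mu]_(x in `[0, 1])
    (network (Theta s) x * (network (Theta s) x - f x))).
  exact: (bounded_measurable_Rintegral mt _ I01_lty
    (bounded_measurable_energy mt bf bTheta)).
set c := \int[mu]_(x in `[0, 1]) (`|f x| ^+ 2).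
have : \int[mu]_(s in `[0, t]) (- (4^-1 * c)) <=
    \int[mu]_(s in `[0, t]) (\int[mu]_(x in `[0, 1])
      (network (Theta s) x * (network (Theta s) x - f x))).
  apply: le_Rintegral => //.
  - apply: bounded_measurable_integrable => //.
    exact: bounded_measurable_cst.
  - by apply: bounded_measurable_integrable.
  - by move=> s _; exact: energy_ge.
rewrite Rintegral_cst//= fine_lebesgue_measure_itv// subr0; lra.
Qed.

End GradientFlow.

Theorem proposition5p1 (R : realType) (H : nat) (H_gt0 : (0 < H)%N)
  (f : R -> R) (f_cont : {within `[0, 1], continuous f})
  (G : 'rV[R]_(3 * H).+1 -> 'rV[R]_(3 * H).+1)
  (G_w : forall (phi : 'rV[R]_(3 * H).+1) (j : 'I_H),
     G phi ord0 (idx_w j) =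
     2 * outw phi j *
     \int[lebesgue_measure]_(x in `[0, 1])
       (x * (network phi x - f x) *
        \1_(`]0, +oo[) (wgt phi j * x + bias phi j)))
  (G_b : forall (phi : 'rV[R]_(3 * H).+1) (j : 'I_H),
     G phi ord0 (idx_b j) =
     2 * outw phi j *
     \int[lebesgue_measure]_(x in `[0, 1])
       ((network phi x - f x) *
        \1_(`]0, +oo[) (wgt phi j * x + bias phi j)))
  (G_v : forall (phi : 'rV[R]_(3 * H).+1) (j : 'I_H),
     G phi ord0 (idx_v j) =
     2 * \int[lebesgue_measure]_(x in `[0, 1])
       (Num.max (wgt phi j * x + bias phi j) 0 * (network phi x - f x)))
  (G_c : forall phi : 'rV[R]_(3 * H).+1,
     G phi ord0 (idx_c H) =
     2 * \int[lebesgue_measure]_(x in `[0, 1]) (network phi x - f x))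
  (Theta : R -> 'rV[R]_(3 * H).+1)
  (Theta_cont : {within `[0, +oo[, continuous Theta})
  (Theta_flow : forall t : R, 0 <= t -> forall i : 'I_(3 * H).+1,
     Theta t ord0 i =
     Theta 0 ord0 i -
     \int[lebesgue_measure]_(s in `[0, t]) (G (Theta s) ord0 i)) :
  (forall t : R, 0 <= t ->
     lyapunov (Theta t) =
       lyapunov (Theta 0) -
       8 * \int[lebesgue_measure]_(s in `[0, t])
             (\int[lebesgue_measure]_(x in `[0, 1])
                (network (Theta s) x * (network (Theta s) x - f x))) /\
     lyapunov (Theta 0) -
       8 * \int[lebesgue_measure]_(s in `[0, t])
             (\int[lebesgue_measure]_(x in `[0, 1])
                (network (Theta s) x * (network (Theta s) x - f x))) <=
       lyapunov (Theta 0) +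
       2 * t * \int[lebesgue_measure]_(x in `[0, 1]) (`|f x| ^+ 2)) /\
  (forall t : R, 0 <= t ->
     eucl_norm (Theta t) <=
       Num.sqrt (lyapunov (Theta 0)) +
       Num.sqrt (2 * \int[lebesgue_measure]_(x in `[0, 1]) (`|f x| ^+ 2)) *
       Num.sqrt t).
Proof.
have le t (t0 : 0 <= t) := lyapunov_flow_le f_cont Theta_cont t0.
have eq t (t0 : 0 <= t) :=
  lyapunov_flow f_cont G_w G_b G_v G_c Theta_cont Theta_flow t0.
split=> t t0; first by split; [exact: eq | exact: le].
apply: (le_trans (eucl_norm_le_lyapunov _)).
set c := \int[lebesgue_measure]_(x in `[0, 1]) (`|f x| ^+ 2).
have c0 : 0 <= c by apply: Rintegral_ge0 => x _; exact: exprn_ge0.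
rewrite -sqrtrM ?mulr_ge0//.
(* Both sides are nonnegative, so their squares are compared: $V(\Theta_t)\le V(\Theta_0)+2tc$, and
   the square of the right side exceeds this bound by a nonnegative cross term. *)
rewrite -(@ler_pXn2r _ 2) ?nnegrE ?addr_ge0 ?sqrtr_ge0//.
rewrite sqrrD !sqr_sqrtr ?mulr_ge0 ?lyapunov_ge0//.
apply: (@le_trans _ _ (lyapunov (Theta 0) + 2 * t * c)).
  by rewrite eq// le.
have : 0 <= Num.sqrt (lyapunov (Theta 0)) * Num.sqrt (2 * c * t).
  by rewrite mulr_ge0 ?sqrtr_ge0.
lra.
Qed.
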